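(* Let $G$ be an interval graph that has a pairing dominating set. Then $G$ has a pairing dominating set whose pairs are adjacent.
   Context: All graphs are finite and simple; $N[v]$ denotes the closed neighborhood of $v$. An interval graph is the intersection graph of a family of closed intervals of the real line: each vertex corresponds to an interval, and two vertices are adjacent if and only if their intervals intersect. A pairing dominating set of a graph $G=(V,E)$ is a set of pairs of vertices $\{(u_1,v_1),\dots,(u_k,v_k)\}$ of $V$ such that all the vertices appearing in the pairs are distinct and $V=\bigcup_{i=1}^k \left(N[u_i]\cap N[v_i]\right)$. Its pairs are adjacent if $u_iv_i\in E$ for every $i$. *)

(* Defs.v *)
From mathcomp Require Import all_boot all_order all_algebra reals.

Set Implicit Arguments.
Unset Strict Implicit.
Unset Printing Implicit Defensive.

Import Order.TTheory GRing.Theory Num.Theory.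

Record sgraph := SGraph {
  vertex :> finType;
  adj : rel vertex;
  adj_sym : symmetric adj;
  adj_irr : irreflexive adj
}.

Definition closed_nbhd (G : sgraph) (v : G) : {set G} :=
  [set w | (w == v) || adj v w].

(* The real line is any [R : realType]. The intervals are the nonempty segments [l v, r v]; distinct
   vertices may receive the same interval, and are then adjacent. *)
Definition interval_graph (R : realType) (G : sgraph) : Prop :=
  exists l r : G -> R,
    (forall v : G, (l v <= r v)%R) /\
    (forall u v : G, u != v ->
       (adj u v <-> exists x : R, x \in `[l u, r u]%R /\ x \in `[l v, r v]%R)).

(* A set of pairs {(u_1,v_1),...,(u_k,v_k)} is listed as a sequence; [uniq]
   says that the 2k vertices u_1,...,u_k,v_1,...,v_k are pairwise distinct,
   hence also that no pair is repeated. *)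
Definition pairing_dominating (G : sgraph) (s : seq (G * G)) : Prop :=
  uniq (unzip1 s ++ unzip2 s) /\
  \bigcup_(p <- s) (closed_nbhd p.1 :&: closed_nbhd p.2) = [set: G].

Definition adjacent_pairs (G : sgraph) (s : seq (G * G)) : Prop :=
  forall p : G * G, p \in s -> adj p.1 p.2.

(* Main.v *)
(* Take a pairing dominating set with the fewest nonadjacent pairs. For every
   nonadjacent pair (u, v), with u left of v, some vertex c is dominated by no
   other pair, since otherwise (u, v) could be dropped. This c belongs to a pair
   {c, x}, since otherwise (u, c) could replace (u, v), and c, x are not adjacent,
   since otherwise {c, x} would dominate c. As c covers the gap between u and v,
   moving from (u, v) to {c, x} goes strictly right or strictly left. The leftmost
   nonadjacent pair can only go right; the last pair that goes right leads to one
   from which the next move goes left, and at such a turn an exchange of partners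
   reduces the number of nonadjacent pairs. *)
Require Import Defs.
From mathcomp Require Import all_boot all_order all_algebra fingroup perm reals.
From mathcomp Require Import boolp lra.

Set Implicit Arguments.
Unset Strict Implicit.
Unset Printing Implicit Defensive.

Import Order.TTheory.

(** * Pairing dominating sets in arbitrary graphs *)

Section Pairings.

Variable G : sgraph.
Implicit Types (s : seq (G * G)) (u v w x y z : G).

(** Pairs are unordered in meaning but listed as ordered ones, hence the two orientations. *)
Definition paired s u v := ((u, v) \in s) || ((v, u) \in s).

Definition covers s z :=
  has (fun p => (z \in closed_nbhd p.1) && (z \in closed_nbhd p.2)) s.

Definition nonadj_pairs s := count (fun p : G * G => ~~ adj p.1 p.2) s.

Lemma pairing_dominatingP s :
  pairing_dominating s <->
  uniq (unzip1 s ++ unzip2 s) /\ forall z, covers s z.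
Proof.
have coverE z : (z \in \bigcup_(p <- s) (closed_nbhd p.1 :&: closed_nbhd p.2))
    = covers s z.
  rewrite /covers; elim: s => [|p s IHs]; first by rewrite big_nil inE.
  by rewrite big_cons in_setU IHs in_setI.
split=> -[Us Ds]; split=> //; first by move=> z; rewrite -coverE Ds inE.
by apply/setP => z; rewrite coverE Ds inE.
Qed.

Lemma coversP s z :
  reflect (exists u v, [/\ paired s u v, z \in closed_nbhd u
                         & z \in closed_nbhd v])
          (covers s z).
Proof.
apply: (iffP hasP) => [[[u v] /= uvs /andP[zu zv]]|[u [v [uvs zu zv]]]].
  by exists u, v; rewrite /paired uvs.
by case/orP: uvs => ?; [exists (u, v)|exists (v, u)]; rewrite //= zu zv.
Qed.

Lemma pairedC s u v : paired s u v = paired s v u.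
Proof. exact: orbC. Qed.

Lemma self_nbhd u : u \in closed_nbhd u.
Proof. by rewrite inE eqxx. Qed.

(** * Uniqueness of the partner *)

Section Uniq.

Variable s : seq (G * G).
Hypothesis Us : uniq (unzip1 s ++ unzip2 s).

Lemma uniq_map_inj_in (T1 T2 : eqType) (f : T1 -> T2) (t : seq T1) :
  uniq (map f t) -> {in t &, injective f}.
Proof.
elim: t => //= a t IHt /andP[fat Ut] b c; rewrite !inE.
move=> /predU1P[->|bt] /predU1P[->|ct] // E.
- by rewrite E map_f in fat.
- by rewrite -E map_f in fat.
- exact: IHt.
Qed.

Lemma paired_neq u v : paired s u v -> u != v.
Proof.
move=> uvs; apply/eqP => E; subst v.
have {}uvs : (u, u) \in s by case/orP: uvs.
move: Us; rewrite cat_uniq => /and3P[_ /hasPn/(_ u) + _].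
by move=> /(_ (map_f snd uvs)); rewrite (map_f fst uvs).
Qed.

Lemma paired_fun u v w : paired s u v -> paired s u w -> v = w.
Proof.
move: Us; rewrite cat_uniq => /and3P[U1 /hasPn U12 U2].
have nb a b c : (a, b) \in s -> (c, a) \in s -> False.
  by move=> /(map_f fst) abs /(map_f snd)/U12; rewrite abs.
move=> /orP[uv|uv] /orP[uw|uw].
- by have [] := uniq_map_inj_in U1 uv uw erefl.
- by case: (nb _ _ _ uv uw).
- by case: (nb _ _ _ uw uv).
- by have [] := uniq_map_inj_in U2 uv uw erefl.
Qed.

End Uniq.

(** * Exchanging partners and dropping pairs *)

Definition transport (t : {perm G}) s := [seq (t p.1, t p.2) | p <- s].

(** A permutation is injective, so distinctness survives. An exchange is a [tperm] of two vertices,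
    one of which may be unpaired. *)
Lemma uniq_transport t s :
  uniq (unzip1 (transport t s) ++ unzip2 (transport t s))
    = uniq (unzip1 s ++ unzip2 s).
Proof.
rewrite -[RHS](map_inj_uniq (@perm_inj _ t)) map_cat.
by rewrite /unzip1 /unzip2 -!map_comp.
Qed.

Lemma paired_transport t s u v :
  paired s u v -> paired (transport t s) (t u) (t v).
Proof.
by move=> /orP[] /(map_f (fun p => (t p.1, t p.2))) uv; rewrite /paired uv ?orbT.
Qed.

Lemma leq_count_in (T : eqType) (a b : pred T) (t : seq T) :
  {in t, subpred a b} -> count a t <= count b t.
Proof.
elim: t => //= e t IHt sub_ab; apply: leq_add.
  by case: (a e) (sub_ab e (mem_head e t)) => // ->.
by apply: IHt => f ft; apply: sub_ab; rewrite inE ft orbT.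
Qed.

Lemma ltn_count_in (T : eqType) (a b : pred T) (t : seq T) e :
  {in t, subpred a b} -> e \in t -> ~~ a e -> b e -> count a t < count b t.
Proof.
move=> sub_ab et nae be; have /seq.permP E := perm_to_rem et.
rewrite !E /= (negbTE nae) be add0n add1n ltnS; apply: leq_count_in => f ft.
by apply: sub_ab; apply: mem_rem ft.
Qed.

(** Swap [x] and [y]: [(c, x)] becomes [(c, y)], and a pair [{y, w}], if any, becomes [{x, w}]. By
    the last two hypotheses the new pairs dominate what the old ones did. Adjacent pairs contain
    neither [x] nor [y], so they stay. *)
Lemma exchange s c x y :
    pairing_dominating s -> paired s c x -> ~~ adj c x -> adj c y ->
    (forall w, paired s y w -> ~~ adj y w) ->
    (forall z, z \in closed_nbhd c -> z \in closed_nbhd x ->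
       z \in closed_nbhd y \/ exists2 w, paired s y w & z \in closed_nbhd w) ->
    (forall z w, paired s y w -> z \in closed_nbhd y -> z \in closed_nbhd w ->
       z \in closed_nbhd c) ->
  exists2 s', pairing_dominating s' & nonadj_pairs s' < nonadj_pairs s.
Proof.
move=> /pairing_dominatingP[Us Ds] cx ncx cy ny Dcx Dyw.
have neq_cx : c != x := paired_neq Us cx.
have neq_cy : c != y by apply: contraTneq cy => ->; rewrite adj_irr.
have neq_xy : x != y by apply: contraNneq ncx => ->.
pose t := tperm x y.
have tc : t c = c by rewrite tpermD // eq_sym.
have tx : t x = y := tpermL x y.
have ty : t y = x := tpermR x y.
have tfix a b : paired s a b -> adj a b -> t a = a.
  move=> ab adj_ab; rewrite tpermD //; apply/eqP => E; subst a.
    move: ncx; rewrite adj_sym (paired_fun Us (u := x) (v := c) (w := b)) //.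
      by rewrite adj_ab.
    by rewrite pairedC.
  by move: (ny _ ab); rewrite adj_ab.
have tP a b : paired s a b -> paired (transport t s) (t a) (t b).
  exact: paired_transport.
exists (transport t s).
  apply/pairing_dominatingP; split; first by rewrite uniq_transport.
  have Dcy z : z \in closed_nbhd c -> z \in closed_nbhd y ->
      covers (transport t s) z.
    move=> zc zy; apply/coversP; exists c, y; split=> //.
    by rewrite -{1}tc -tx tP.
  have Dx z : z \in closed_nbhd c -> z \in closed_nbhd x ->
      covers (transport t s) z.
    move=> zc zx; have [zy|[w yw zw]] := Dcx z zc zx; first exact: Dcy.
    apply/coversP; exists x, w; split=> //.
    rewrite -ty -[w](_ : t w = w) ?tP // tpermD //; last exact: paired_neq yw.
    apply/eqP => E; subst w; case/eqP: neq_cy.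
    by apply: (paired_fun Us (u := x)); rewrite pairedC.
  move=> z; have /coversP[u [v [uv zu zv]]] := Ds z.
  (* An end moved by [t] is [x] or [y], and then [z] is covered by a new pair. A pair with both ends
     fixed survives. *)
  have half a b : paired s a b -> z \in closed_nbhd a -> z \in closed_nbhd b ->
      (t a == a) || covers (transport t s) z.
    have [->|ax] := eqVneq a x => ab za zb.
      have bc : b = c by apply: (paired_fun Us ab); rewrite pairedC.
      by rewrite Dx ?orbT // -bc.
    have [E|ay] := eqVneq a y; last by rewrite tpermD ?eqxx // eq_sym.
    by subst a; rewrite Dcy ?orbT //; apply: Dyw ab za zb.
  have /orP[/eqP tu|//] := half u v uv zu zv.
  have /orP[/eqP tv|//] := half v u (etrans (pairedC s v u) uv) zv zu.
  by apply/coversP; exists u, v; split=> //; rewrite -tu -tv tP.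
rewrite /nonadj_pairs /transport count_map.
have sub : {in s, subpred (preim (fun p => (t p.1, t p.2))
    (fun p : G * G => ~~ adj p.1 p.2)) (fun p : G * G => ~~ adj p.1 p.2)}.
  move=> [a b] abs /=; apply: contra => adj_ab.
  have ab : paired s a b by rewrite /paired abs.
  by rewrite (tfix a b) // (tfix b a) // ?[paired s b a]pairedC // adj_sym.
(* The count drops strictly at [{c, x}], which becomes the adjacent pair [{c, y}]. *)
case/orP: cx => cxs; apply: (ltn_count_in sub cxs);
  by rewrite /= ?tc ?tx ?negbK // adj_sym.
Qed.

Lemma drop_pair s u v :
    pairing_dominating s -> paired s u v -> ~~ adj u v ->
    (forall z, z \in closed_nbhd u -> z \in closed_nbhd v ->
       exists a b, [/\ paired s a b, z \in closed_nbhd a, z \in closed_nbhd b,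
                       (a, b) != (u, v) & (b, a) != (u, v)]) ->
  exists2 s', pairing_dominating s' & nonadj_pairs s' < nonadj_pairs s.
Proof.
wlog uvs : u v / (u, v) \in s => [IH sP|].
  case/orP => [uv|vu] nuv D; first by apply: (IH u v); rewrite // /paired uv.
  apply: (IH v u); rewrite // ?/paired ?vu // 1?adj_sym // => z zv zu.
  have [a [b [ab za zb N1 N2]]] := D z zu zv.
  by exists a, b; split; rewrite // xpair_eqE andbC.
move=> /pairing_dominatingP[Us Ds] _ nuv D.
have Urem : uniq (unzip1 (rem (u, v) s) ++ unzip2 (rem (u, v) s)).
  apply: subseq_uniq Us.
  by apply: cat_subseq; apply: map_subseq; apply: rem_subseq.
exists (rem (u, v) s); last first.
  rewrite /nonadj_pairs; have /seq.permP -> := perm_to_rem uvs.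
  by rewrite /= nuv.
apply/pairing_dominatingP; split=> // z.
have inrem a b : (a, b) \in s -> (a, b) != (u, v) -> (a, b) \in rem (u, v) s.
  have /perm_mem -> := perm_to_rem uvs.
  by rewrite inE => /predU1P[->|//]; rewrite eqxx.
suff [a [b [ab za zb N1 N2]]] : exists a b,
    [/\ paired s a b, z \in closed_nbhd a, z \in closed_nbhd b,
        (a, b) != (u, v) & (b, a) != (u, v)].
  apply/coversP; exists a, b; split=> //.
  by case/orP: ab => ab; rewrite /paired (inrem _ _ ab) ?orbT.
have /coversP[a [b [ab za zb]]] := Ds z.
have [[E1 E2]|N1] := eqVneq (a, b) (u, v); first by subst; apply: D.
have [[E1 E2]|N2] := eqVneq (b, a) (u, v); first by subst; apply: D.
by exists a, b.
Qed.

End Pairings.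

(** * Interval representations *)

Section Intervals.

Variables (R : realType) (G : sgraph) (l r : G -> R).
Hypothesis le_lr : forall v, (l v <= r v)%R.
Hypothesis adj_itv : forall u v : G, u != v ->
  (adj u v <-> exists x : R, x \in `[l u, r u]%R /\ x \in `[l v, r v]%R).

Local Open Scope ring_scope.

Lemma nbhd_itv (v w : G) :
  (w \in closed_nbhd v) = (l v <= r w) && (l w <= r v).
Proof.
rewrite inE; case: eqVneq => [->|neq_wv] /=; first by rewrite !le_lr.
rewrite eq_sym in neq_wv; apply/idP/andP => [/(adj_itv neq_wv)[x []]|[vw wv]].
  by rewrite !in_itv /= => /andP[? ?] /andP[? ?]; split; lra.
apply/(adj_itv neq_wv); have := le_lr v; have := le_lr w => ? ?.
(* The larger left endpoint lies in both intervals. *)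
have [lvw|lwv] := leP (l v) (l w).
  by exists (l w); rewrite !in_itv /=; split; apply/andP; split; lra.
by exists (l v); rewrite !in_itv /=; split; apply/andP; split; lra.
Qed.

Lemma adj_itvE (u v : G) : adj u v = (u != v) && (l u <= r v) && (l v <= r u).
Proof.
rewrite -andbA -nbhd_itv inE eq_sym.
by case: eqVneq => //= ->; rewrite adj_irr.
Qed.

Lemma nonadj_itv (u v : G) : u != v -> ~~ adj u v -> r u < l v \/ r v < l u.
Proof.
move=> neq_uv; rewrite adj_itvE neq_uv /= negb_and -!ltNge.
by case/orP; [right|left].
Qed.

(** * Pairings with the fewest nonadjacent pairs *)

Section Minimal.

Variable s : seq (G * G).
Hypothesis sP : pairing_dominating s.
Hypothesis s_min :
  ~ exists2 s' : seq (G * G), pairing_dominating s' &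
    (nonadj_pairs s' < nonadj_pairs s)%N.

Let Us : uniq (unzip1 s ++ unzip2 s).
Proof. by case: sP. Qed.

(** Boolean, so that [goes_right] below is a predicate over which a maximum can be taken. *)
Definition private u v c :=
  [&& c \in closed_nbhd u, c \in closed_nbhd v &
      [forall a, forall b,
         [&& paired s a b, c \in closed_nbhd a & c \in closed_nbhd b] ==>
         ((a, b) == (u, v)) || ((b, a) == (u, v))]].

Lemma privateP u v c :
  reflect [/\ c \in closed_nbhd u, c \in closed_nbhd v &
            forall a b, paired s a b -> c \in closed_nbhd a ->
              c \in closed_nbhd b -> (a, b) = (u, v) \/ (b, a) = (u, v)]
          (private u v c).
Proof.
apply: (iffP and3P) => -[cu cv H]; split=> //.
  move=> a b ab ca cb; have /forallP/(_ b) := forallP H a.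
  by rewrite ab ca cb /= => /orP[]/eqP; [left|right].
apply/forallP => a; apply/forallP => b; apply/implyP => /and3P[ab ca cb].
by case: (H a b ab ca cb) => ->; rewrite eqxx ?orbT.
Qed.

Lemma private_ex u v : paired s u v -> ~~ adj u v -> exists c, private u v c.
Proof.
move=> uv nuv; apply: contrapT => nopriv; apply: s_min.
apply: (drop_pair sP uv nuv) => z zu zv; apply: contrapT => H.
apply: nopriv; exists z; apply/privateP; split=> // a b ab za zb.
have [|N1] := eqVneq (a, b) (u, v); first by left.
have [|N2] := eqVneq (b, a) (u, v); first by right.
by case: H; exists a, b.
Qed.

Lemma private_partner u v c : paired s u v -> r u < l v -> private u v c ->
  exists2 x, paired s c x & r c < l x \/ r x < l c.
Proof.
move=> uv ruv /privateP[cu cv cP].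
have nuv : ~~ adj u v by rewrite adj_itvE; lra.
(* The intervals of [u] and [v] are disjoint, while [c] meets both. *)
have neq_uc : u != c by apply: contraTneq cv => <-; rewrite nbhd_itv; lra.
have neq_vc : v != c by apply: contraTneq cu => <-; rewrite nbhd_itv; lra.
have adj_uc : adj u c by move: cu; rewrite inE eq_sym (negPf neq_uc).
have [x cx] : exists x, paired s c x.
  apply: contrapT => nc; apply: s_min.
  apply: (exchange sP uv nuv adj_uc).
  - by move=> w cw; case: nc; exists w.
  (* A vertex that meets both [u] and [v] spans the gap from [r u] to [l v], as [c] does, so it
     meets [c]. *)
  - move: cu cv; rewrite !nbhd_itv => /andP[? ?] /andP[? ?] z.
    rewrite !nbhd_itv => /andP[? ?] /andP[? ?]; left.
    by apply/andP; split; lra.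
  - by move=> z w cw; case: nc; exists w.
exists x => //; apply: nonadj_itv; first exact: paired_neq cx.
apply/negP => adj_cx.
have xc : c \in closed_nbhd x by rewrite inE adj_sym adj_cx orbT.
by case: (cP c x cx (self_nbhd c) xc) => -[E1 E2]; subst;
  rewrite eqxx in neq_uc neq_vc.
Qed.

(* If [c] extends further left than [d], then [d] is dominated by [(u, v)] as
   well; otherwise [(c, x)] and [(y, d)] can be replaced by [(c, y)] and [(d, x)]. *)
Lemma no_turn u v c x d y :
  paired s u v -> r u < l v -> private u v c ->
  paired s c x -> r c < l x -> private c x d ->
  paired s d y -> r y < l d -> False.
Proof.
move=> uv ruv /privateP[cu cv _] cx rcx /privateP[dc dx dP] dy ryd.
move: (cu) (cv) (dc) (dx).
rewrite !nbhd_itv => /andP[? ?] /andP[? ?] /andP[? ?] /andP[? ?].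
have := (le_lr u, le_lr v) => -[? ?].
have [lcd|ldc] := leP (l c) (l d); last first.
  (* Here [d] starts before [r u] and, since it reaches [l x], ends after [l v]. *)
  have du : d \in closed_nbhd u by rewrite nbhd_itv; apply/andP; split; lra.
  have dv : d \in closed_nbhd v by rewrite nbhd_itv; apply/andP; split; lra.
  by case: (dP u v uv du dv) => -[E1 E2]; subst; lra.
have xc : paired s x c by rewrite pairedC.
apply: s_min; apply: (exchange sP dy (y := x)).
- by rewrite adj_itvE; lra.
- rewrite adj_itvE -andbA; apply/and3P; split; try lra.
  by apply: contraTneq dc => ->; rewrite nbhd_itv; lra.
- by move=> w xw; rewrite -(paired_fun Us xc xw) adj_itvE; lra.
(* Both [z] and [c], the partner of [x], contain the point [l d]. *)
- move=> z; rewrite !nbhd_itv => /andP[? ?] /andP[? ?]; right.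
  by exists c; rewrite // nbhd_itv; apply/andP; split; lra.
(* Now [w] is [c], and both [z] and [d] span the gap from [r c] to [l x]. *)
- move=> z w xw; rewrite -(paired_fun Us xc xw) !nbhd_itv.
  by move=> /andP[? ?] /andP[? ?]; apply/andP; split; lra.
Qed.

(** A nonadjacent pair oriented from left to right, whichever way it is listed in [s]. *)
Definition bad (p : G * G) := paired s p.1 p.2 && (r p.1 < l p.2).

Definition goes_right (p : G * G) := bad p &&
  [exists c, exists x, [&& private p.1 p.2 c, paired s c x & r c < l x]].

Lemma bad_cases p : bad p -> goes_right p \/
  exists c x, [/\ private p.1 p.2 c, paired s c x & r x < l c].
Proof.
move=> bp; have /andP[pp rp] := bp.
have nadj : ~~ adj p.1 p.2 by rewrite adj_itvE; lra.
have [c cP] := private_ex pp nadj.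
have [x cx [rcx|rxc]] := private_partner pp rp cP; [left|right].
  rewrite /goes_right bp; apply/existsP; exists c; apply/existsP; exists x.
  exact/and3P.
by exists c, x.
Qed.

Lemma minimal_adjacent : adjacent_pairs s.
Proof.
move=> e es; apply: contraT => nadj.
have pe : paired s e.1 e.2 by rewrite /paired -surjective_pairing es.
have [p0 bp0] : exists p0, bad p0.
  have [re|re] := nonadj_itv (paired_neq Us pe) nadj.
    by exists e; apply/andP.
  by exists (e.2, e.1); rewrite /bad /= pairedC pe.
case: (arg_minP (fun p => l p.2) bp0) => p bp pmin.
have right_p : goes_right p.
  (* Otherwise [(x, c)] would be bad with [l c <= r p.1 < l p.2], against the choice of [p]. *)
  have [//|[c [x [/privateP[c1 c2 _] cx rxc]]]] := bad_cases bp.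
  have /andP[_ rp] := bp.
  have : l p.2 <= l c by apply: (pmin (x, c)); rewrite /bad /= pairedC cx.
  by move: c1; rewrite nbhd_itv => /andP[? ?] ?; lra.
case: (arg_maxP (fun p => l p.2) right_p) => q /andP[bq Eq] qmax.
have /existsP[c /existsP[x /and3P[cP cx rcx]]] := Eq.
have /andP[qq rq] := bq.
have bcx : bad (c, x) by rewrite /bad /= cx.
have [rc|[d [y [dP dy ryd]]]] := bad_cases bcx; last first.
  by case: (no_turn qq rq cP cx rcx dP dy ryd).
(* As [c] meets [q.2], [l q.2 <= r c < l x], so [(c, x)] would go right from beyond [q]. *)
have := qmax _ rc; case/privateP: cP; rewrite !nbhd_itv /=.
by move=> _ /andP[? ?] _ ?; lra.
Qed.

End Minimal.

End Intervals.

Theorem proposition4p4 (R : realType) (G : sgraph)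
    (HG : interval_graph R G)
    (HD : exists s : seq (G * G), pairing_dominating s) :
  exists s : seq (G * G), pairing_dominating s /\ adjacent_pairs s.
Proof.
have [l [r [le_lr adj_itv]]] := HG; have [s sP] := HD.
(* Induction on the number of nonadjacent pairs: either it can be lowered or [s] is minimal. *)
have [n] := ubnP (nonadj_pairs s); elim: n s sP => // n IHn s sP le_sn.
have [[s' s'P lt_s's]|s_min] := EM (exists2 s' : seq (G * G),
  pairing_dominating s' & nonadj_pairs s' < nonadj_pairs s).
  by apply: (IHn s'); rewrite // (leq_trans lt_s's).
by exists s; split=> //; apply: minimal_adjacent le_lr adj_itv _ sP s_min.
Qed.
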